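(* Let $k\geq 4$ and let $G$ be a graph with maximum degree $\Delta(G)\le k$ that is $(k-1)$-saturated. Then $G$ is $(1^{k-1},2^{k-1})$-packing colorable.
   Context: Graphs are finite and simple; $\mathrm{dist}(x,y)$ is the usual shortest-path distance. For a non-decreasing sequence of positive integers $S=(s_1,\dots,s_p)$, an $S$-packing coloring of $G$ is a partition of $V(G)$ into sets $V_1,\dots,V_p$ such that any two distinct vertices of $V_i$ are at distance greater than $s_i$, for each $1\le i\le p$; $G$ is $S$-packing colorable if such a partition exists. The notation $i^r$ in a sequence means that $i$ is repeated $r$ times, so $(1^{k-1},2^{k-1})$ is the sequence of $k-1$ ones followed by $k-1$ twos. A vertex of degree $k$ is called a $k$-vertex. A graph $G$ with $\Delta(G)\le k$ is called $t$-saturated ($0\le t\le k$) if every $k$-vertex of $G$ is adjacent to at most $t$ vertices of degree $k$. *)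

(* Defs.v *)
(* A finite simple graph is a symmetric irreflexive [e : rel T]
   on [T : finType]. *)
From mathcomp Require Import all_boot.

Set Implicit Arguments.
Unset Strict Implicit.
Unset Printing Implicit Defensive.

Section Graphs.

Variables (T : finType) (e : rel T).
Implicit Types x y v : T.

Definition neighbors v : {set T} := [set u | e v u].

Definition deg v : nat := #|neighbors v|.

Definition max_degree : nat := \max_(v : T) deg v.

Definition walk_of_length x y (n : nat) : bool :=
  [exists p : n.-tuple T, path e x p && (last x p == y)].

Lemma connect_walk x y : connect e x y -> exists n, walk_of_length x y n.
Proof.
case/connectP=> p e_p ->; exists (size p).
by apply/existsP; exists (in_tuple p); rewrite e_p eqxx.
Qed.

(* [None] stands for infinite distance (distinct connected components). *)
Definition dist x y : option nat :=
  match @idP (connect e x y) with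
  | ReflectT xy => Some (ex_minn (connect_walk xy))
  | ReflectF _ => None
  end.

Definition dist_gt x y (s : nat) : bool :=
  if dist x y is Some d then s < d else true.

Definition saturated (k t : nat) : Prop :=
  forall v, deg v = k -> #|[set u in neighbors v | deg u == k]| <= t.

(* Classes are indexed from 0 and may be empty. *)
Definition packing_coloring (S : seq nat) (V : 'I_(size S) -> {set T}) : Prop :=
  [/\ \bigcup_i V i = [set: T],
      forall i j, i != j -> [disjoint V i & V j]
    & forall i x y, x \in V i -> y \in V i -> x != y -> dist_gt x y (nth 0 S i)].

Definition packing_colorable (S : seq nat) : Prop :=
  exists V : 'I_(size S) -> {set T}, packing_coloring V.

End Graphs.

(* Main.v *)
(* Saturation makes [G] (k-1)-degenerate, hence properly k-colorable; take a
   k-coloring whose last class [R] is as small as possible.  Swapping Kempe chains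
   shows, through Hall's theorem, that [R] can be matched into each of the other
   k-1 color classes.  So every [v] in [R] owns k-1 neighbors, no vertex being
   owned twice, and has at most one further neighbor.  Two vertices of [R] at
   distance 2 share a neighbor that is extra for one of them, which defines an
   out-degree-one digraph on [R]; since moreover no vertex has k neighbors in [R],
   the conflict graph on [R] is (k-2)-degenerate, and [R] splits into k-1
   2-packings. *)
Require Import Defs.
From mathcomp Require Import all_boot zify.

Set Implicit Arguments.
Unset Strict Implicit.
Unset Printing Implicit Defensive.

(** * Degenerate graphs and Hall's theorem *)

(** Remove a vertex with at most [m] neighbors in [X] and color the rest by induction; one of the
    [m.+1] colors is then missing around it. *)
Lemma greedy_coloring (T : finType) (r : rel T) (m : nat) (X : {set T}) :
  symmetric r -> irreflexive r ->
  (forall S : {set T}, S \subset X -> S != set0 ->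
     exists2 v, v \in S & #|[set u in S | r v u]| <= m) ->
  exists c : {ffun T -> 'I_m.+1}, {in X &, forall x y, r x y -> c x != c y}.
Proof.
move=> r_sym r_irr; move: {2}#|X| (leqnn #|X|) => s.
elim: s X => [|s IHs] X leXs dgn.
  exists [ffun=> ord0] => x y.
  by move: leXs; rewrite leqn0 cards_eq0 => /eqP->; rewrite inE.
have [X0|Xn0] := eqVneq X set0.
  by exists [ffun=> ord0] => x y; rewrite X0 inE.
have [v vX vdeg] := dgn X (subxx _) Xn0.
have [||c c_ok] := IHs (X :\ v).
- by move: leXs; rewrite (cardsD1 v) vX.
- by move=> S /subset_trans sS; apply: dgn; apply: sS; apply: subD1set.
have [i iP] : exists i, i \notin c @: [set u in X | r v u].
  apply/existsP; rewrite -negb_forall; apply/negP => /forallP all_c.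
  have := leq_trans (leq_imset_card c _) vdeg.
  suff -> : c @: [set u in X | r v u] = setT by rewrite cardsT card_ord ltnn.
  by apply/setP => i; rewrite inE; apply: all_c.
have i_ok y : y \in X -> r v y -> c y != i.
  move=> yX vy; apply: contraNneq iP => <-.
  by apply: imset_f; rewrite inE yX.
exists [ffun x => if x == v then i else c x] => x y xX yX xy; rewrite !ffunE.
have [xv|xv] := eqVneq x v; have [yv|yv] := eqVneq y v.
- by rewrite xv yv r_irr in xy.
- by rewrite eq_sym i_ok // -xv.
- by rewrite i_ok // -yv r_sym.
- by apply: c_ok => //; rewrite !inE ?xv ?yv.
Qed.

(* Rado's argument: as long as some [N a] has two elements, one of them can be
   removed without breaking Hall's condition. *)
Lemma hall_matching (A B : finType) (N : A -> {set B}) :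
  (forall S : {set A}, #|S| <= #|\bigcup_(a in S) N a|) ->
  exists2 f : A -> B, injective f & forall a, f a \in N a.
Proof.
move: {2}(\sum_a #|N a|) (leqnn (\sum_a #|N a|)) => s.
elim: s N => [|s IHs] N leNs hallN.
  (* Hall's condition on a singleton makes [N a] nonempty, so a zero sum forces [A] to be empty. *)
  have A0 (a : A) : False.
    have := hallN [set a]; rewrite cards1 big_set1 => Na.
    by move: leNs; rewrite (bigD1 a) //=; lia.
  by exists (fun a => match A0 a return B with end) => a; case: (A0 a).
have [/forallP N1|/forallPn[a aP]] := boolP [forall a, #|N a| == 1].
  have /fin_all_exists[f fP] a : exists b, N a = [set b] by apply/cards1P.
  exists f => [a b fab|a]; last by rewrite fP set11.
  apply/eqP/negPn/negP => ab.
  have := hallN [set a; b]; rewrite cards2 ab.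
  by rewrite big_setU1 ?inE //= big_set1 !fP fab setUid cards1.
have {aP} Na2 : 1 < #|N a|.
  by have := hallN [set a]; rewrite cards1 big_set1; lia.
have [x [y [xN yN xy]]] := card_gt1P Na2.
pose M b a' := if a' == a then N a' :\ b else N a'.
have sumM b : b \in N a -> \sum_a' #|M b a'| <= s.
  move=> bN; move: leNs; rewrite (bigD1 a) //= (bigD1 a (P := predT)) //=.
  rewrite /M eqxx (cardsD1 b (N a)) bN addSn ltnS.
  by under [X in _ -> _ + X <= _]eq_bigr => i /negPf-> do [].
have subM b a' : M b a' \subset N a' by rewrite /M; case: eqP; rewrite ?subD1set.
have doneM b : b \in N a -> (forall S : {set A}, #|S| <= #|\bigcup_(a' in S) M b a'|) ->
    exists2 f : A -> B, injective f & forall a', f a' \in N a'.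
  move=> bN /(IHs _ (sumM b bN))[f finj fM].
  by exists f => // a'; apply: (subsetP (subM b a')).
have [/forallP/(doneM x xN)//|/forallPn[S1]] :=
  boolP [forall S : {set A}, #|S| <= #|\bigcup_(a' in S) M x a'|].
have [/forallP/(doneM y yN)//|/forallPn[S2]] :=
  boolP [forall S : {set A}, #|S| <= #|\bigcup_(a' in S) M y a'|].
rewrite -!ltnNge => lt2 lt1.
set U1 := \bigcup_(a' in S1) M x a' in lt1.
set U2 := \bigcup_(a' in S2) M y a' in lt2.
(* Deleting [b] only alters [N a], so both violators [S1] and [S2] must contain [a]. *)
have notin b (S : {set A}) : a \notin S ->
    \bigcup_(a' in S) M b a' = \bigcup_(a' in S) N a'.
  move=> aS; apply: eq_bigr => a' a'S; rewrite /M; case: eqP => // a'a.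
  by rewrite -a'a a'S in aS.
have a1 : a \in S1.
  by apply/negPn/negP => /(notin x) E; move: lt1; rewrite /U1 E ltnNge hallN.
have a2 : a \in S2.
  by apply/negPn/negP => /(notin y) E; move: lt2; rewrite /U2 E ltnNge hallN.
(* As [x] and [y] differ, the two reduced copies of [N a] together still cover [N a]. *)
have subU : \bigcup_(a' in S1 :|: S2) N a' \subset U1 :|: U2.
  apply/bigcupsP => a' a'S; apply/subsetP => b bN.
  have [aa'|aa'] := eqVneq a' a.
    have [bx|bx] := eqVneq b x; rewrite inE.
      apply/orP; right; apply/bigcupP; exists a => //.
      by rewrite /M eqxx !inE -aa' bN bx xy.
    by apply/orP; left; apply/bigcupP; exists a => //; rewrite /M eqxx !inE -aa' bN bx.
  rewrite inE; move: a'S; rewrite inE => /orP[] a'S; apply/orP; [left|right];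
    by apply/bigcupP; exists a' => //; rewrite /M (negPf aa').
have subI : \bigcup_(a' in (S1 :&: S2) :\ a) N a' \subset U1 :&: U2.
  apply/bigcupsP => a'; rewrite !inE => /and3P[aa' aS1 aS2]; apply/subsetP => b bN.
  by rewrite inE; apply/andP; split; apply/bigcupP; exists a' => //; rewrite /M (negPf aa').
(* Hall's condition on the union and on the intersection without [a] gives
   [#|U1| + #|U2| >= #|S1| + #|S2| - 1], whereas the two violations give at most
   [#|S1| + #|S2| - 2]. *)
have := leq_trans (hallN _) (subset_leq_card subU).
have := leq_trans (hallN _) (subset_leq_card subI).
have := cardsUI S1 S2; have := cardsUI U1 U2.
have := cardsD1 a (S1 :&: S2); rewrite inE a1 a2 /=; lia.
Qed.

(** * Distance bounds from the absence of short walks *)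

Lemma dist_gtP (T : finType) (e : rel T) (x y : T) (s : nat) :
  (forall m, m <= s -> ~~ walk_of_length e x y m) -> dist_gt e x y s.
Proof.
move=> nowalk; rewrite /dist_gt /dist; case: {-}_ / idP => // xy.
case: ex_minnP => m wm _; rewrite ltnNge; apply/negP => /nowalk.
by rewrite wm.
Qed.

Lemma dist_gt1 (T : finType) (e : rel T) (x y : T) :
  x != y -> ~~ e x y -> dist_gt e x y 1.
Proof.
move=> xy nexy; apply: dist_gtP => -[|[|//]] _; apply/existsP => -[p].
  by rewrite tuple0 /= (negPf xy).
case/tupleP: p => a p; rewrite tuple0 /= andbT => /andP[ea /eqP ay].
by rewrite -ay ea in nexy.
Qed.

Lemma dist_gt2 (T : finType) (e : rel T) (x y : T) :
  x != y -> ~~ e x y -> (forall u, e x u -> ~~ e u y) -> dist_gt e x y 2.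
Proof.
move=> xy nexy no_u; apply: dist_gtP => -[|[|[|//]]] _; apply/existsP => -[p].
- by rewrite tuple0 /= (negPf xy).
- case/tupleP: p => a p; rewrite tuple0 /= andbT => /andP[ea /eqP ay].
  by rewrite -ay ea in nexy.
case/tupleP: p => a p; case/tupleP: p => b p; rewrite tuple0 /= andbT.
by case/andP => /andP[/no_u/negPf nay ab] /eqP by_; rewrite -by_ ab in nay.
Qed.

(** * Colorings with a smallest last class; [n.+2] stands for k *)

Section MinimalColoring.

Variables (T : finType) (e : rel T) (n : nat).
Hypotheses (e_sym : symmetric e) (e_irr : irreflexive e).
Hypothesis deg_le : forall v, deg e v <= n.+2.

Definition proper (c : {ffun T -> 'I_n.+2}) := forall x y, e x y -> c x != c y.

Definition last_class (c : {ffun T -> 'I_n.+2}) : {set T} :=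
  [set x | c x == ord_max].

Variable c : {ffun T -> 'I_n.+2}.
Hypothesis c_proper : proper c.
Hypothesis c_min : forall c', proper c' -> #|last_class c| <= #|last_class c'|.

Let R := last_class c.

Definition color_neighbors j v := [set u in neighbors e v | c u == j].

Lemma last_class_stable x y : x \in R -> y \in R -> ~~ e x y.
Proof.
rewrite !inE => /eqP xR /eqP yR; apply/negP => /c_proper.
by rewrite xR yR eqxx.
Qed.

(** Otherwise [v] could be recolored with [j], which would shrink the last class. *)
Lemma color_neighbors_gt0 v j : v \in R -> j != ord_max ->
  0 < #|color_neighbors j v|.
Proof.
move=> vR jz; rewrite card_gt0; apply/negP => /eqP N0.
have no_u u : e v u -> c u != j.
  move=> vu; apply/negP => cu.
  by have := in_set0 u; rewrite -N0 !inE vu cu.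
pose c' := [ffun x => if x == v then j else c x].
have c'P : proper c'.
  move=> x y xy; rewrite !ffunE.
  have [xv|xv] := eqVneq x v; have [yv|yv] := eqVneq y v.
  - by rewrite xv yv e_irr in xy.
  - by rewrite eq_sym no_u // -xv.
  - by rewrite no_u // -yv e_sym.
  - exact: c_proper.
have := c_min c'P; rewrite leqNgt => /negP; apply.
rewrite [X in _ < X](cardsD1 v) -/R vR; apply: subset_leq_card.
apply/subsetP => x; rewrite !inE ffunE.
by case: (eqVneq x v) => //= _; rewrite (negPf jz).
Qed.

Lemma deg_sum_color v : deg e v = \sum_j #|color_neighbors j v|.
Proof.
rewrite /deg -sum1_card (partition_big c predT) //=.
apply: eq_bigr => j _; rewrite -sum1_card; apply: eq_bigl => u.
by rewrite !inE.
Qed.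

(** Each of the [n] colors other than [j] and [ord_max] accounts for at least one neighbor of
    [v]. *)
Lemma color_neighbors_deg v j : v \in R -> j != ord_max ->
  n + #|color_neighbors j v| <= deg e v.
Proof.
move=> vR jz; rewrite deg_sum_color (bigD1 j) //= addnC leq_add2l.
rewrite (bigD1 ord_max) 1?eq_sym //=; apply: leq_trans (leq_addl _ _).
apply: (@leq_trans (\sum_(i : 'I_n.+2 | (i != j) && (i != ord_max)) 1)); last first.
  by apply: leq_sum => i /andP[_ iz]; apply: color_neighbors_gt0.
rewrite sum1dep_card.
have -> : [set i | (i != j) && (i != ord_max)] = ~: [set j; ord_max].
  by apply/setP => i; rewrite !inE negb_or.
by have := cardsC [set j; ord_max]; rewrite cards2 jz card_ord; lia.
Qed.

Lemma color_neighbors_le2 v j : v \in R -> j != ord_max ->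
  #|color_neighbors j v| <= 2.
Proof.
move=> vR jz; have := leq_trans (color_neighbors_deg vR jz) (deg_le v); lia.
Qed.

(** * Kempe chains and matchings out of the last class *)

(** The closure conditions keep the colors proper when [j] and [ord_max] are exchanged on [A] and
    [U]. The new last class has at most [#|R| - #|A| + #|U|] elements, and minimality of [R]
    concludes. *)
Lemma kempe_swap j (A U : {set T}) : j != ord_max ->
  A \subset R -> (forall u, u \in U -> c u = j) ->
  (forall v, v \in A -> color_neighbors j v \subset U) ->
  (forall u v, u \in U -> v \in R -> e u v -> v \in A) ->
  #|A| <= #|U|.
Proof.
move=> jz sAR Uj NAU NUA.
pose c' := [ffun x => if x \in A then j else if x \in U then ord_max else c x].
have AU_proper x y : x \in A -> y \notin A -> e x y -> c' x != c' y.
  move=> xA yA xy; rewrite !ffunE xA (negPf yA); case: ifP => // /negbT yU.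
  apply: contraNneq yU => cy; apply: (subsetP (NAU x xA)).
  by rewrite !inE xy -cy eqxx.
have U_proper x y : x \in U -> x \notin A -> y \notin A -> y \notin U -> e x y ->
    c' x != c' y.
  move=> xU xA yA yU xy; rewrite !ffunE xU (negPf xA) (negPf yA) (negPf yU).
  by apply: contraNneq yA => cy; apply: (NUA x) => //; rewrite inE -cy.
have c'P : proper c'.
  move=> x y xy.
  have yx : e y x by rewrite e_sym.
  have [xA|xA] := boolP (x \in A); have [yA|yA] := boolP (y \in A).
  - by have := last_class_stable (subsetP sAR _ xA) (subsetP sAR _ yA); rewrite xy.
  - exact: AU_proper.
  - by rewrite eq_sym; apply: AU_proper.
  have [xU|xU] := boolP (x \in U); have [yU|yU] := boolP (y \in U).
  - by have := c_proper xy; rewrite !Uj // eqxx.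
  - exact: U_proper.
  - by rewrite eq_sym; apply: U_proper.
  - by rewrite !ffunE (negPf xA) (negPf yA) (negPf xU) (negPf yU) c_proper.
have sR : last_class c' \subset (R :\: A) :|: U.
  apply/subsetP => x; rewrite !inE ffunE.
  case: (x \in A); first by rewrite (negPf jz).
  by case: (x \in U) => [|->]; rewrite ?orbT.
have := leq_trans (c_min c'P) (subset_leq_card sR).
rewrite -/R cardsU cardsD (setIidPr sAR).
by have := subset_leq_card sAR; lia.
Qed.

(* A violating pair extends to a union of Kempe chains; each vertex of [R] that
   is added brings at most one new vertex of color [j], by
   [color_neighbors_le2]. *)
Lemma kempe_hall j (A U : {set T}) : j != ord_max ->
  A \subset R -> (forall u, u \in U -> c u = j) ->
  (forall v, v \in A -> color_neighbors j v \subset U) ->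
  #|A| <= #|U|.
Proof.
move=> jz; move: {2}#|R :\: A| (erefl #|R :\: A|) => s.
elim: s A U => [|s IHs] A U cardRA sAR Uj NAU.
  apply: (@kempe_swap j) => // u v _ vR _; apply/negPn/negP => vA.
  by have := in_set0 v; rewrite -(cards0_eq cardRA) inE vR vA.
have [/existsP[v /and3P[vR vA /existsP[u /andP[uU vu]]]]|] :=
  boolP [exists v, [&& v \in R, v \notin A & [exists u, (u \in U) && e v u]]].
  have uN : u \in color_neighbors j v by rewrite !inE vu Uj /=.
  have := IHs (v |: A) (U :|: color_neighbors j v).
  rewrite cardsU1 vA => /(_ _ _ _ _) IH.
  have : 1 + #|A| <= #|U :|: color_neighbors j v|.
    apply: IH.
    - have -> : R :\: (v |: A) = (R :\: A) :\ v.
        by apply/setP => x; rewrite !inE negb_or -andbA.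
      by move: cardRA; rewrite (cardsD1 v) inE vA vR add1n => -[].
    - by rewrite subUset sub1set vR.
    - by move=> x; rewrite !inE => /orP[/Uj//|/andP[_ /eqP]].
    - move=> x; rewrite !inE => /orP[/eqP->|/NAU xU]; first exact: subsetUr.
      exact: subset_trans xU (subsetUl _ _).
  have : 0 < #|U :&: color_neighbors j v|.
    by apply/card_gt0P; exists u; rewrite inE uU.
  by rewrite cardsU; have := color_neighbors_le2 vR jz; lia.
move=> closed; apply: (@kempe_swap j) => // u v uU vR uv.
apply: contraNT closed => vA; apply/existsP; exists v; rewrite vR vA /=.
by apply/existsP; exists u; rewrite uU e_sym.
Qed.

Lemma last_class_matching j : j != ord_max ->
  exists2 f : T -> T, {in R &, injective f} &
    {in R, forall v, e v (f v) /\ c (f v) = j}.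
Proof.
move=> jz.
(* Hall's theorem is applied on the subtype of [R], since it matches every element of its domain;
   the result is extended by the identity outside [R]. *)
pose N (v : {v | v \in R}) := color_neighbors j (val v).
have [S|f finj fN] := @hall_matching _ _ N.
  rewrite -(card_imset _ val_inj); apply: (@kempe_hall j) => //.
  - by apply/subsetP => _ /imsetP[v _ ->]; apply: valP.
  - by move=> u /bigcupP[v _]; rewrite !inE => /andP[_ /eqP].
  - by move=> _ /imsetP[v vS ->]; apply/subsetP => u uN; apply/bigcupP; exists v.
exists (fun v => oapp f v (insub v)) => [v w vR wR|v vR].
  by rewrite !insubT /= => /finj[].
by rewrite insubT /=; have := fN (Sub v vR); rewrite !inE /= => /andP[-> /eqP].
Qed.

(** Take the images of [v] under the matchings into the [n.+1] other classes: the color of an image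
    tells which matching it came from, and each matching is injective. *)
Lemma last_class_stars :
  exists2 F : T -> {set T},
    {in R, forall v, F v \subset neighbors e v /\ #|F v| = n.+1} &
    {in R &, forall v w u, u \in F v -> u \in F w -> v = w}.
Proof.
have /fin_all_exists[f fP] j : exists f : T -> T, j != ord_max ->
    {in R &, injective f} /\ {in R, forall v, e v (f v) /\ c (f v) = j}.
  (* Nothing is asked of [f] at [ord_max]; [id] is a placeholder there. *)
  have [jz|jz] := eqVneq j ord_max; first by exists id.
  by have [f finj fN] := last_class_matching jz; exists f.
exists (fun v => [set f j v | j in predC1 ord_max]) => [v vR|v w vR wR u].
  split.
    apply/subsetP => _ /imsetP[j jz ->].
    by rewrite inE; have [_ /(_ v vR)[]] := fP j jz.
  rewrite card_in_imset ?cardC1 ?card_ord // => i j iz jz fij.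
  have [_ /(_ v vR)[_ <-]] := fP i iz; have [_ /(_ v vR)[_ <-]] := fP j jz.
  by rewrite fij.
case/imsetP => i iz ->; case/imsetP => j jz fij.
have ij : i = j.
  have [_ /(_ v vR)[_ <-]] := fP i iz; have [_ /(_ w wR)[_ <-]] := fP j jz.
  by rewrite fij.
by move: fij; rewrite -ij; have [finj _] := fP i iz; apply: finj.
Qed.

(* If all neighbors of [u] lay in [R], then [u] could take any color; recoloring
   it would free its color for a neighbor of degree less than [n.+2], which has
   exactly one neighbor of each color. *)
Lemma last_class_degree u : saturated e n.+2 n.+1 -> 0 < n -> u \notin R ->
  #|[set v in R | e u v]| <= n.+1.
Proof.
move=> sat n_gt0 uR; rewrite leqNgt; apply/negP => big.
have sub : [set v in R | e u v] \subset neighbors e u.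
  by apply/subsetP => v; rewrite !inE => /andP[].
have degu : deg e u = n.+2.
  by apply/eqP; rewrite eqn_leq deg_le (leq_trans big) // subset_leq_card.
have NuR v : e u v -> v \in R.
  move=> uv; have : v \in neighbors e u by rewrite inE.
  suff <- : [set v in R | e u v] = neighbors e u by rewrite inE => /andP[].
  by apply/eqP; rewrite eqEcard sub (leq_trans (deg_le u)).
have [v uv degv] : exists2 v, e u v & deg e v < n.+2.
  have [/exists_inP[v uv dv]|/exists_inPn alldeg] :=
    boolP [exists v in neighbors e u, deg e v < n.+2].
    by exists v => //; rewrite inE in uv.
  have := sat u degu; suff -> : [set w in neighbors e u | deg e w == n.+2] = neighbors e u.
    by rewrite -/(deg e u) degu ltnn.
  apply/setP => w; rewrite [LHS]inE; case: (boolP (w \in _)) => //= /alldeg.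
  by rewrite -leqNgt eqn_leq deg_le => ->.
have vR := NuR v uv.
have jz : c u != ord_max by move: uR; rewrite inE.
(* There are at least three colors because [n] is positive. *)
have [i iz ij] : exists2 i : 'I_n.+2, i != ord_max & i != c u.
  apply/exists_inP; apply: contraT => /exists_inPn all_i.
  have := subset_leq_card (_ : [set: 'I_n.+2] \subset [set ord_max; c u]).
  rewrite cardsT card_ord cards2 => H; suff : n.+2 <= 2 by lia.
  apply: leq_trans (H _) _; last by case: (_ != _).
  apply/subsetP => i _; rewrite !inE; case: (eqVneq i ord_max) => //= iz.
  by have := all_i i iz; rewrite negbK.
(* A second neighbor of color [c u] would push the degree of [v] up to [n.+2], by
   [color_neighbors_deg]. *)
have only_u w : e v w -> c w = c u -> w = u.
  move=> vw cw; apply/eqP/negPn/negP => wu.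
  have two : 2 <= #|color_neighbors (c u) v|.
    have <- : #|[set u; w]| = 2 by rewrite cards2 eq_sym wu.
    apply: subset_leq_card; apply/subsetP => x; rewrite !inE => /orP[] /eqP->.
      by rewrite e_sym uv eqxx.
    by rewrite vw cw eqxx.
  by have := color_neighbors_deg vR jz; lia.
pose c' := [ffun x => if x == u then i else if x == v then c u else c x].
have uv_neq : v != u by apply: contraTneq uv => ->; rewrite e_irr.
have u_proper x y : x = u -> e x y -> c' x != c' y.
  move=> -> uy; rewrite !ffunE eqxx; case: (eqVneq y u) => [yu|_].
    by rewrite yu e_irr in uy.
  by case: ifP => // _; have := NuR y uy; rewrite inE => /eqP->.
have v_proper x y : x = v -> y != u -> e x y -> c' x != c' y.
  move=> -> yu vy; rewrite !ffunE (negPf uv_neq) eqxx (negPf yu).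
  case: (eqVneq y v) => [yv|_]; first by rewrite yv e_irr in vy.
  by apply: contraNneq yu => /esym/(only_u _ vy) ->.
have c'P : proper c'.
  move=> x y xy; have yx : e y x by rewrite e_sym.
  have [xu|xu] := eqVneq x u; first exact: u_proper.
  have [yu|yu] := eqVneq y u; first by rewrite eq_sym u_proper.
  have [xv|xv] := eqVneq x v; first exact: v_proper.
  have [yv|yv] := eqVneq y v; first by rewrite eq_sym v_proper.
  by rewrite !ffunE (negPf xu) (negPf xv) (negPf yu) (negPf yv) c_proper.
have := c_min c'P; rewrite leqNgt => /negP; apply.
rewrite [X in _ < X](cardsD1 v) -/R vR; apply: subset_leq_card.
apply/subsetP => x; rewrite !inE ffunE.
case: (eqVneq x u) => [_ /eqP iz'|_]; first by rewrite iz' eqxx in iz.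
by case: (eqVneq x v) => //= _; rewrite (negPf jz).
Qed.

(** * Degeneracy of the conflict graph on the last class *)

(** On the stable set [R] this means being at distance exactly 2. *)
Definition conflict : rel T := [rel x y | (x != y) && [exists u, e x u && e y u]].

(** If some vertex of [S] has no incoming arc, all its conflicts pass through its single extra
    neighbor. Otherwise the arcs form a permutation of [S], and conflicts join only consecutive
    vertices of its cycles. *)
Lemma conflict_degenerate (S : {set T}) : saturated e n.+2 n.+1 -> 1 < n ->
  S \subset R -> S != set0 ->
  exists2 v, v \in S & #|[set w in S | conflict v w]| <= n.
Proof.
move=> sat n_gt1 /subsetP sSR /set0Pn[v0 v0S].
have [F F_R F_inj] := last_class_stars.
(* The neighbors outside the star: at most one, since the star uses [n.+1] of at most [n.+2]. *)
pose X v := neighbors e v :\: F v.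
have X1 v u u' : v \in R -> u \in X v -> u' \in X v -> u = u'.
  move=> vR uX uX'; have [sF cF] := F_R v vR.
  have : #|X v| <= 1 by rewrite cardsD (setIidPr sF) cF leq_subLR addn1 deg_le.
  by move/card_le1_eqP; apply.
have NP v u : e v u -> (u \in F v) || (u \in X v).
  by rewrite inE [u \in neighbors e v]inE => ->; case: (u \in F v).
pose arc v w := [exists u, (u \in X v) && (u \in F w)].
have arcI v w u : u \in X v -> u \in F w -> arc v w.
  by move=> uv uw; apply/existsP; exists u; rewrite uv.
have arc_fun v w w' : v \in S -> w \in S -> w' \in S -> arc v w -> arc v w' -> w = w'.
  move=> vS wS w'S /existsP[u /andP[uX uF]] /existsP[u' /andP[u'X u'F]].
  rewrite (X1 v u' u) ?sSR // in u'F.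
  by apply: (F_inj w w' _ _ u); rewrite ?sSR.
(* Stars are disjoint, so a common neighbor in the star of [v] must be the extra neighbor of [w]. *)
have F_conflict v w u : v \in S -> w \in S -> v != w -> e w u -> u \in F v -> arc w v.
  move=> vS wS vw wu uF; have /orP[uF'|uX] := NP w u wu; last exact: arcI uX uF.
  by rewrite (F_inj v w _ _ u) ?sSR ?eqxx in vw.
have [/exists_inP[v vS /exists_inPn no_in]|/exists_inPn all_in] :=
  boolP [exists v in S, ~~ [exists w in S, arc w v]].
  exists v => //.
  have wX w u : w \in S -> v != w -> e v u -> e w u -> u \in X v.
    move=> wS vw vu wu; have /orP[uF|//] := NP v u vu.
    by have := no_in w wS; rewrite (F_conflict v w u).
  have [X0|[u uX]] := set_0Vmem (X v).
    rewrite (_ : [set w in S | conflict v w] = set0) ?cards0 //.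
    apply/setP => w; rewrite !inE; apply/negP => /and3P[wS vw /existsP[u /andP[vu wu]]].
    by have := wX w u wS vw vu wu; rewrite X0 inE.
  have vu : e v u by move: uX; rewrite !inE => /andP[].
  have uR : u \notin R.
    by apply/negP => uR; have := last_class_stable (sSR v vS) uR; rewrite vu.
  (* The extra neighbor [u] has at most [n.+1] neighbors in [R], one of which is [v] itself. *)
  have := last_class_degree sat (ltnW n_gt1) uR.
  rewrite (cardsD1 v) inE sSR // e_sym vu ltnS; apply: leq_trans.
  apply: subset_leq_card; apply/subsetP => w.
  rewrite inE => /and3P[wS vw /existsP[u' /andP[vu' wu']]].
  rewrite !inE eq_sym vw e_sym (X1 v u u') ?sSR // ?(wX w u') // wu' andbT.
  by have := sSR w wS; rewrite inE.
(* [h] chooses a predecessor. Out-degrees are at most one, so [h] is injective, hence a permutation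
   of [S], and every arc inside [S] comes from it. *)
have /fin_all_exists[h hP] v : exists w, v \in S -> w \in S /\ arc w v.
  have [vS|vS] := boolP (v \in S); last by exists v.
  by have := all_in v vS; rewrite negbK => /exists_inP[w wS wv]; exists w.
have h_inj : {in S &, injective h}.
  move=> v w vS wS hvw; have [hvS hv] := hP v vS; have [_ hw] := hP w wS.
  by apply: (arc_fun (h v)) => //; rewrite hvw.
have h_surj v : v \in S -> exists2 w, w \in S & v = h w.
  suff hS : h @: S = S by rewrite -{1}hS => /imsetP[w wS ->]; exists w.
  apply/eqP; rewrite eqEcard card_in_imset // leqnn andbT.
  by apply/subsetP => _ /imsetP[w /hP[hwS _] ->].
have [v' v'S v0v'] := h_surj v0 v0S.
have arc_h v w : v \in S -> w \in S -> arc v w -> v = h w.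
  move=> vS wS vw; have [w' w'S hw'] := h_surj v vS.
  have [_ aw'] := hP w' w'S.
  by rewrite hw' (arc_fun v w w') // hw'.
(* Only the predecessor [h v0] and the successor [v'] of [v0] can conflict with it, and [2 <= n]. *)
exists v0 => //; apply: leq_trans n_gt1.
apply: (@leq_trans #|[set h v0; v']|); last by rewrite cards2; case: (_ != _).
apply: subset_leq_card; apply/subsetP => w.
rewrite inE => /and3P[wS vw /existsP[u /andP[vu wu]]]; rewrite !inE.
have /orP[uF|uX] := NP v0 u vu.
  by rewrite (arc_h w v0) ?eqxx //; apply: F_conflict uF.
have [_ /existsP[u' /andP[u'X u'F]]] := hP v' v'S.
rewrite -v0v' in u'X; rewrite (X1 v0 u' u) ?sSR // in u'F.
have [->|wv'] := eqVneq w v'; first by rewrite orbT.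
have := arc_h w v' wS v'S; rewrite (F_conflict v' w u) // 1?eq_sym // => /(_ isT) wv0.
by rewrite wv0 v0v' eqxx in vw.
Qed.

End MinimalColoring.

(** * Assembling the packing coloring *)

Lemma packing_colorableP (T : finType) (e : rel T) (S : seq nat) (d : T -> nat) :
  (forall x, d x < size S) ->
  (forall x y, x != y -> d x = d y -> dist_gt e x y (nth 0 S (d x))) ->
  packing_colorable e S.
Proof.
move=> d_lt d_dist; exists (fun i : 'I_(size S) => [set x | d x == i]); split.
- apply/setP => x; rewrite inE; apply/bigcupP.
  by exists (Ordinal (d_lt x)); rewrite ?inE.
- move=> i j ij; rewrite -setI_eq0; apply/eqP/setP => x; rewrite !inE.
  by apply: contraNF ij => /andP[/eqP di /eqP dj]; apply/eqP/val_inj; rewrite /= -di.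
- move=> i x y; rewrite !inE => /eqP <- /eqP dy xy.
  by apply: d_dist.
Qed.

Theorem theorem4p1 (k : nat) (T : finType) (e : rel T)
    (k_ge4 : 4 <= k)
    (e_sym : symmetric e) (e_irr : irreflexive e)
    (e_max : max_degree e <= k)
    (e_sat : saturated e k (k - 1)) :
  packing_colorable e (nseq (k - 1) 1 ++ nseq (k - 1) 2).
Proof.
case: k k_ge4 e_max e_sat => [|[|n]] // n_ge2 e_max; rewrite subSS subn0 => e_sat.
have deg_le v : deg e v <= n.+2 by apply: leq_trans e_max; apply: leq_bigmax.
have [S _ /set0Pn[v vS]|c0 c0P] := @greedy_coloring T e n.+1 setT e_sym e_irr.
  (* Either [S] has a vertex of degree below k, or all its vertices have degree k and saturation
     leaves each at most [n.+1] neighbors in [S]. *)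
  have [/exists_inP[w wS dw]|/exists_inPn big] :=
    boolP [exists w in S, deg e w <= n.+1].
    exists w => //; apply: leq_trans dw; apply: subset_leq_card.
    by apply/subsetP => u; rewrite !inE => /andP[].
  have bigS w : w \in S -> deg e w = n.+2.
    by move=> /big; rewrite -ltnNge => ?; apply/eqP; rewrite eqn_leq deg_le.
  exists v => //; apply: leq_trans (e_sat v (bigS v vS)).
  apply: subset_leq_card; apply/subsetP => u; rewrite !inE => /andP[uS ->].
  by rewrite bigS ?eqxx.
pose properb (c : {ffun T -> 'I_n.+2}) := [forall x, forall y, e x y ==> (c x != c y)].
have properP c : reflect (proper e c) (properb c).
  by apply: (iffP 'forall_'forall_implyP).
have c0b : properb c0 by apply/properP => x y; apply: c0P.
case: (arg_minnP (fun c => #|last_class c|) c0b) => c /properP c_proper c_minb.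
have c_min (c' : {ffun T -> 'I_n.+2}) : proper e c' -> #|last_class c| <= #|last_class c'|.
  by move=> c'P; apply: c_minb; apply/properP.
have conf_sym : symmetric (conflict e).
  move=> x y; rewrite /conflict /= eq_sym; congr andb.
  by apply: eq_existsb => u; rewrite andbC.
have conf_irr : irreflexive (conflict e) by move=> x; rewrite /conflict /= eqxx.
have [S sS S0|d dP] := @greedy_coloring T (conflict e) n (last_class c) conf_sym conf_irr.
  exact: (conflict_degenerate e_sym e_irr deg_le c_proper c_min).
(* The first [n.+1] colors are kept as the classes of radius 1; the last class is split by [d] among
   the indices from [n.+1] on, which carry radius 2. *)
apply: (@packing_colorableP _ _ _
  (fun x => if x \in last_class c then n.+1 + d x else c x)).
  move=> x; rewrite size_cat !size_nseq; case: ifP => _.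
    by rewrite ltn_add2l.
  by apply: leq_trans (ltn_ord _) _; rewrite addSn addnS !ltnS leq_addr.
have c_lt x : x \notin last_class c -> c x < n.+1.
  by rewrite inE => cx; rewrite ltn_neqAle -ltnS ltn_ord andbT.
move=> x y xy; have [xR|xR] := boolP (x \in last_class c);
  have [yR|yR] := boolP (y \in last_class c).
- move=> /addnI/val_inj dxy.
  have -> : nth 0 (nseq n.+1 1 ++ nseq n.+1 2) (n.+1 + d x) = 2.
    rewrite nth_cat size_nseq ifN; last by rewrite -leqNgt leq_addr.
    by rewrite addKn nth_nseq ltn_ord.
  apply: dist_gt2 => //; first exact: last_class_stable xR yR.
  move=> u xu; apply/negP => uy.
  have cxy : conflict e x y.
    by rewrite /conflict /= xy; apply/existsP; exists u; rewrite xu e_sym.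
  by have := dP x y xR yR cxy; rewrite dxy eqxx.
- by move=> E; have := c_lt y yR; rewrite -E; lia.
- by move=> E; have := c_lt x xR; rewrite E; lia.
- move=> /val_inj cxy; have -> : nth 0 (nseq n.+1 1 ++ nseq n.+1 2) (c x) = 1.
    by rewrite nth_cat size_nseq c_lt // nth_nseq c_lt.
  by apply: dist_gt1 => //; apply/negP => /c_proper; rewrite cxy eqxx.
Qed.
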